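(* Let $X$ be a real Banach space, $I=\{1,\ldots,m\}$, $J=\{1,\ldots,l\}$, $f_0,f_i,g_j\colon X\to\mathbb{R}$, and let $\overline{x}$ be a locally optimal solution of $$\min f_0(x)\quad\text{s.t.}\quad f_i(x)=0\ \forall i\in I,\quad g_j(x)\le0\ \forall j\in J.$$ Let $J(\overline{x})=\{j\in J\mid g_j(\overline{x})=0\}$ and suppose: (i) $f_0$ is quasidifferentiable and Hadamard directionally differentiable at $\overline{x}$; (ii) the functions $f_i$, $i\in I$, are continuous in a neighbourhood of $\overline{x}$ and quasidifferentiable at $\overline{x}$ uniformly along finite dimensional spaces; (iii) the functions $g_j$, $j\notin J(\overline{x})$, are upper semicontinuous and quasidifferentiable at $\overline{x}$, while $g_j$, $j\in J(\overline{x})$, are quasidifferentiable at $\overline{x}$ uniformly along finite dimensional spaces; (iv) vectors $x_i^*\in\underline{\partial} f_i(\overline{x})$, $y_i^*\in\overline{\partial} f_i(\overline{x})$, $i\in I$, and $z_j^*\in\overline{\partial} g_j(\overline{x})$, $j\in J(\overline{x})$, satisfy: (1) for any $i\in I$ there exists $v_i\in X$ with $s(\underline{\partial} f_i(\overline{x})+y_i^*,v_i)<0$ and, for all $k\ne i$, $s(\underline{\partial} f_k(\overline{x})+y_k^*,v_i)\le0$, $s(-x_k^*-\overline{\partial} f_k(\overline{x}),v_i)\le0$; (2) for any $i\in I$ there exists $w_i\in X$ with $s(-x_i^*-\overline{\partial} f_i(\overline{x}),w_i)<0$ and, for all $k\ne i$, $s(-x_k^*-\overline{\partial} f_k(\overline{x}),w_i)\le0$,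 $s(\underline{\partial} f_k(\overline{x})+y_k^*,w_i)\le0$; (3) there exists $v_0\in X$ with $s(\underline{\partial} g_j(\overline{x})+z_j^*,v_0)<0$ for all $j\in J(\overline{x})$ and $s(\underline{\partial} f_i(\overline{x})+y_i^*,v_0)\le0$, $s(-x_i^*-\overline{\partial} f_i(\overline{x}),v_0)\le0$ for all $i\in I$. Then for any $y_0^*\in\overline{\partial} f_0(\overline{x})$ and any $z_j^*\in\overline{\partial} g_j(\overline{x})$, $j\notin J(\overline{x})$, there exist $\lambda_j\ge0$, $j\in J$, such that $\lambda_jg_j(\overline{x})=0$ for all $j\in J$ and $$0\in\underline{\partial} f_0(\overline{x})+y_0^*+\sum_{j=1}^l\lambda_j\big(\underline{\partial} g_j(\overline{x})+z_j^*\big)+\operatorname{cl}^*\operatorname{cone}\{C_i\mid i\in I\},$$ where $C_i=(\underline{\partial} f_i(\overline{x})+y_i^* )\cup(-x_i^*-\overline{\partial} f_i(\overline{x}))$.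
   Context: $X^*$ is the dual with pairing $\langle\cdot,\cdot\rangle$; $\operatorname{cl}^*$ is weak$^*$ closure. $f$ is d.d. at $x$ if $f'(x,v)=\lim_{\alpha\to+0}(f(x+\alpha v)-f(x))/\alpha$ exists finitely for all $v$; Hadamard d.d. if $\lim_{[\alpha,v']\to[+0,v]}(f(x+\alpha v')-f(x))/\alpha$ exists finitely for all $v$; d.d. uniformly along finite dimensional spaces if for any $v$, finite dimensional subspace $X_0$ and $\varepsilon>0$ there is $\delta>0$ with $|(f(x+\alpha v')-f(x))/\alpha-f'(x,v)|<\varepsilon$ whenever $0<\alpha<\delta$, $v'\in v+X_0$, $\|v'-v\|<\delta$. $f$ is quasidifferentiable at $x$ if d.d. and there is a pair $[\underline{\partial} f(x),\overline{\partial} f(x)]$ of convex weak$^*$ compact subsets of $X^*$ with $f'(x,v)=\max_{x^*\in\underline{\partial} f(x)}\langle x^*,v\rangle+\min_{y^*\in\overline{\partial} f(x)}\langle y^*,v\rangle$ for all $v$ (uniformly along finite dimensional spaces if also d.d. in that uniform sense); a specific quasidifferential is fixed for each function. $s(C,v)=\sup_{x^*\in C}\langle x^*,v\rangle$. $\operatorname{cone}$ of a family of sets is the set of finite nonnegative linear combinations of elements of their union. Sums are Minkowski sums. *)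

(* Defs.v *)
From HB Require Import structures.
From mathcomp Require Import all_boot all_order all_algebra.
From mathcomp Require Import all_classical all_reals all_analysis.
Set Implicit Arguments. Unset Strict Implicit. Unset Printing Implicit Defensive.
Import Order.TTheory GRing.Theory Num.Theory.
Import numFieldNormedType.Exports.
Local Open Scope classical_set_scope.
Local Open Scope ring_scope.

Section Defs.
Variables (R : realType) (X : normedModType R).

Definition ptws_fun := prod_topology (fun _ : X => R).

Definition dual : set (X -> R) :=
  [set f | (forall (a : R) (x y : X), f (a *: x + y) = a * f x + f y)
           /\ continuous f].

(* The weak* topology on Xdual is the topology of pointwise convergence
   (ptws_fun) restricted to Xdual. *)
Definition wstar_compact (C : set (X -> R)) : Prop :=
  C `<=` dual /\ @compact ptws_fun C.

Definition wstar_closure (A : set (X -> R)) : set (X -> R) :=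
  @closure ptws_fun A `&` dual.

Definition convex_set (C : set (X -> R)) : Prop :=
  forall f g (t : R), C f -> C g -> 0 <= t <= 1 ->
    C (fun x => t * f x + (1 - t) * g x).

Definition supp (C : set (X -> R)) (v : X) : \bar R :=
  ereal_sup [set (f v)%:E | f in C].

Definition msum (A B : set (X -> R)) : set (X -> R) :=
  [set h | exists2 a, A a & exists2 b, B b & h = (fun x => a x + b x)].
Definition transl (A : set (X -> R)) (y : X -> R) : set (X -> R) :=
  msum A [set y].
Definition oppset (A : set (X -> R)) : set (X -> R) :=
  [set h | exists2 a, A a & h = (fun x => - a x)].

Definition cone_fam (I : Type) (F : I -> set (X -> R)) : set (X -> R) :=
  [set h | exists n (c : 'I_n -> R) (g : 'I_n -> X -> R),
     (forall k, 0 <= c k) /\ (forall k, exists i, F i (g k)) /\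
     h = (fun x => \sum_(k < n) c k * g k x)].

Definition ddir (f : X -> R) (x v : X) (l : R) : Prop :=
  (fun a : R => (f (x + a *: v) - f x) / a) @ at_right 0 --> l.

Definition dir_diff (f : X -> R) (x : X) : Prop :=
  forall v, exists l, ddir f x v l.

Definition hadamard_dir_diff (f : X -> R) (x : X) : Prop :=
  forall v : X, exists l : R,
    (fun p : R * X => (f (x + p.1 *: p.2) - f x) / p.1)
      @ filter_prod (at_right (0 : R)) (nbhs (v : X)) --> l.

(* directional differentiability uniformly along finite dimensional
   subspaces; a finite dimensional subspace X0 is the span of finitely
   many vectors e_0, ..., e_{n-1} *)
Definition dir_diff_unif (f : X -> R) (x : X) : Prop :=
  dir_diff f x /\
  forall v l, ddir f x v l ->
  forall n (e : 'I_n -> X) (eps : R), 0 < eps ->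
  exists2 delta : R, 0 < delta &
    forall (a : R) (c : 'I_n -> R),
      0 < a < delta ->
      `|(\sum_(k < n) c k *: e k)| < delta ->
      `|(f (x + a *: (v + \sum_(k < n) c k *: e k)) - f x) / a - l| < eps.

Definition qd_formula (f : X -> R) (x : X) (lo up : set (X -> R)) : Prop :=
  forall v l, ddir f x v l ->
    exists2 a, lo a & exists2 b, up b &
      l = a v + b v /\
      (forall a', lo a' -> a' v <= a v) /\
      (forall b', up b' -> b v <= b' v).

Definition qd_sets (lo up : set (X -> R)) : Prop :=
  convex_set lo /\ wstar_compact lo /\ convex_set up /\ wstar_compact up.

Definition quasidiff (f : X -> R) (x : X) (lo up : set (X -> R)) : Prop :=
  dir_diff f x /\ qd_sets lo up /\ qd_formula f x lo up.

Definition quasidiff_unif (f : X -> R) (x : X) (lo up : set (X -> R)) : Prop :=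
  dir_diff_unif f x /\ qd_sets lo up /\ qd_formula f x lo up.

Definition usc_at (g : X -> R) (x : X) : Prop :=
  forall eps : R, 0 < eps -> \forall y \near x, g y < g x + eps.

End Defs.

(* Main.v *)
Require Import Defs.
From HB Require Import structures.
From mathcomp Require Import all_boot all_order all_algebra fingroup perm.
From mathcomp Require Import all_classical all_reals all_analysis.
From mathcomp Require Import zify ring lra.
Import Order.TTheory GRing.Theory Num.Theory.
Import numFieldNormedType.Exports.
Local Open Scope classical_set_scope.
Local Open Scope ring_scope.

(* Let K be the set of directions on which all the support functions of the
   sets C_i are nonpositive.

   Primal part.  The quasidifferential inequalities -q_i <= f_i' <= p_i, with
   p_i and q_i the two support functions attached to C_i, show that bending a
   direction v of K slightly towards the vectors v_i (resp. w_i) makes f_i'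
   negative (resp. positive).  So, for small a, the map
   t |-> f_i(xbar + a (v + sum_i t_i^- v_i + t_i^+ w_i)) changes sign between
   opposite faces of a small cube, and the Poincare-Miranda theorem yields
   points satisfying the equality constraints in directions arbitrarily close
   to v.  If moreover g_j'(v) < 0 for the active j, these points are feasible,
   whence f_0'(v) >= 0 by Hadamard differentiability.

   Dual part.  The Slater-like direction v_0 turns this implication into the
   exact penalty inequality s_0 + sum_j L_j max(0, s_j) >= 0 on K.  Its left
   side is the support function of a convex weak* compact set of functions
   a + sum_j lam_j b_j with 0 <= lam_j <= L_j, and such a set must meet the
   opposite of the weak* closed cone generated by the C_i: by compactness it
   suffices to test finitely many points of X at a time, where it is a
   separation of a convex set from the origin of R^r.

   The Poincare-Miranda theorem is reduced to a statement about 0/1-labellings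
   L_1, ..., L_n of a grid.  The sum over all simplices of the Freudenthal
   triangulation of the cup product dL_1 u ... u dL_n modulo 2 is, by discrete
   Stokes, unchanged when L_k is replaced by another labelling with the same
   values on the faces x_k = 0 and x_k = p; and it is 1 for L_k = [x_k > 0]. *)

(** * A parity lemma on grids *)

Lemma addF2 (x : 'F_2) : x + x = 0.
Proof. by apply/val_inj; case: x => [[|[|]]]. Qed.

Lemma addF2_eq (x y : 'F_2) : x + y = 0 -> x = y.
Proof. by move=> h; rewrite -[x]addr0 -(addF2 y) addrA h add0r. Qed.

Section FreudenthalGrid.
Variables n p : nat.
Implicit Types (q : {ffun 'I_n -> 'I_p}) (s : 'S_n).

(* The vertices of the simplex with least vertex q, where s i is the time at
   which coordinate i is incremented (the inverse of the usual convention). *)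
Definition vtx q s (j : nat) : 'I_n -> nat := fun i => (q i + (s i < j))%N.

(* Every interior facet through the other vertices belongs to two simplices with
   the same least vertex, exchanged by the transposition of t-1 and t. *)
Lemma sum_vtx_swap (Phi : (nat -> 'I_n -> nat) -> 'F_2) (t : nat) :
  (0 < t < n)%N ->
  (forall x x', (forall j, j != t -> x j = x' j) -> Phi x = Phi x') ->
  \sum_q \sum_s Phi (vtx q s) = 0.
Proof.
move=> /andP[t0 tn] PhiP; apply: big1 => q _.
have t1n : (t.-1 < n)%N by lia.
pose a := Ordinal t1n; pose b := Ordinal tn; pose pi := tperm a b.
have ab : a != b by apply/eqP => /(congr1 val) /=; lia.
(* [P] compares the coordinates incremented at times t-1 and t. Composing with [pi] exchanges these
   two, so it pairs the permutations satisfying [P] with the others. *)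
pose P s := ((s^-1)%g a < (s^-1)%g b)%N.
rewrite (bigID P) /= [X in _ + X](reindex_inj (mulIg pi)) /=.
rewrite [X in _ + X](_ : _ = \sum_(s | P s) Phi (vtx q s)) ?addF2//.
apply: eq_big => [s|s _].
  rewrite /P invMg !permM /pi tpermV tpermL tpermR.
  have : (s^-1)%g a != (s^-1)%g b by apply: contra ab => /eqP /perm_inj ->.
  by rewrite -val_eqE -leqNgt leq_eqVlt eq_sym => /negPf ->.
apply: PhiP => j jt; apply/funext => i; rewrite /vtx permM; congr (_ + _)%N.
by congr nat_of_bool; case: tpermP => [->|->|//] /=; lia.
Qed.

(* The facet opposite to the first vertex of a simplex is the facet opposite to
   the last vertex of the next one; the cyclic shift of the coordinate i0 only
   wraps around on the boundary, where Phi vanishes. *)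
Lemma sum_vtx_rot (Phi : (nat -> 'I_n -> nat) -> 'F_2) :
  (0 < n)%N ->
  (forall x x', (forall j, (j < n)%N -> x j = x' j) -> Phi x = Phi x') ->
  (forall i x, (forall j, (j < n)%N -> x j i = 0%N) -> Phi x = 0) ->
  (forall i x, (forall j, (j < n)%N -> x j i = p) -> Phi x = 0) ->
  \sum_q \sum_s Phi (fun j => vtx q s j.+1) = \sum_q \sum_s Phi (vtx q s).
Proof.
move=> n0 PhiP Phi0 Phip; pose z := Ordinal n0.
pose c := perm (can_inj (@ord_predK n)).
rewrite exchange_big [RHS]exchange_big /= [RHS](reindex_inj (mulIg c)) /=.
apply: eq_bigr => s _; pose i0 := (s^-1)%g z.
have si0 : s i0 = z by rewrite /i0 permKV.
pose h q := [ffun i => if i == i0 then ordS (q i) else q i].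
have hinj : injective h.
  move=> q q' /ffunP e; apply/ffunP => i; have := e i; rewrite !ffunE.
  by case: eqP => // _ /ordS_inj.
rewrite [RHS](reindex_inj hinj); apply: eq_bigr => q _.
have p0 := ltn_ord (q i0).
have sc i : (s * c)%g i = ord_pred (s i) by rewrite permM permE.
have vc i : nat_of_ord ((s * c)%g i) = if s i == z then n.-1 else (s i).-1.
  rewrite sc /= -val_eqE /=; have si := ltn_ord (s i).
  case: eqP => [->|/eqP si0']; first by rewrite add0n modn_small //; lia.
  have -> : ((s i + n).-1 = (s i).-1 + n)%N by lia.
  by rewrite modnDr modn_small //; lia.
have [qp|qp] := eqVneq (q i0 : nat) p.-1.
  rewrite (Phip i0) ?(Phi0 i0)//.
    move=> j jn; rewrite /vtx ffunE eqxx /= qp vc si0 eqxx.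
    by rewrite prednK ?modnn; lia.
  by move=> j jn; rewrite /vtx qp si0 /=; lia.
apply: PhiP => j jn; apply/funext => i; rewrite /vtx ffunE vc.
have [->|ii0] := eqVneq i i0; first by rewrite si0 eqxx /= modn_small; lia.
have : s i != z by rewrite -si0 (inj_eq perm_inj).
by rewrite -val_eqE /= => si; rewrite (negbTE si); lia.
Qed.

Variable L : 'I_n -> ('I_n -> nat) -> 'F_2.

(** The coboundary of the 0-cochain [L i] on the j-th edge of the path x; modulo 2 a difference is a
    sum. *)
Definition edge (x : nat -> 'I_n -> nat) (i : 'I_n) (j : nat) : 'F_2 :=
  L i (x j) + L i (x j.+1).

Section OneForm.
Variables (k : 'I_n) (M : ('I_n -> nat) -> 'F_2).
Hypothesis L0 : forall i y, i != k -> y i = 0%N -> L i y = 0.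
Hypothesis L1 : forall i y, i != k -> y i = p -> L i y = 1.
Hypothesis M0 : forall y, y k = 0%N -> M y = 0.
Hypothesis M1 : forall y, y k = p -> M y = 0.

(** Modulo 2, the two consecutive edges of i0 add up to an expression without the vertex [(a i0).+1]
    between them. The side conditions keep all other factors off this vertex, so [sum_vtx_swap]
    cancels the total. *)
Lemma sum_edge_shift (b : nat) (a a' : 'I_n -> nat) (i0 : 'I_n) :
  i0 != k -> ((a i0).+1 < n)%N -> a' i0 = (a i0).+1 ->
  (forall i, i != i0 -> i != k ->
     a' i = a i /\ a i <> (a i0).+1 /\ a i <> a i0) ->
  b <> (a i0).+1 ->
  \sum_q \sum_s M (vtx q s b) * \prod_(i | i != k) edge (vtx q s) i (a i) =
  \sum_q \sum_s M (vtx q s b) * \prod_(i | i != k) edge (vtx q s) i (a' i).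
Proof.
move=> i0k ai0 a'i0 aa' bi0; apply: addF2_eq.
rewrite -big_split /=; under eq_bigr => q _ do rewrite -big_split /=.
pose Phi (x : nat -> 'I_n -> nat) :=
  M (x b) * ((L i0 (x (a i0)) + L i0 (x (a i0).+2)) *
   \prod_(i | (i != k) && (i != i0)) edge x i (a i)).
rewrite -[RHS](@sum_vtx_swap Phi (a i0).+1) ?ai0//.
  apply: eq_bigr => q _; apply: eq_bigr => s _.
  rewrite /Phi (bigD1 i0)//= [X in _ + _ * X](bigD1 i0)//= -mulrDr.
  rewrite [X in _ * (_ + _ * X)](eq_bigr (fun i => edge (vtx q s) i (a i))).
    rewrite -mulrDl; congr (_ * (_ * _)).
    by rewrite /edge a'i0 addrACA [X in _ + X]addrC addrACA addF2 addr0.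
  by move=> i /andP[ik ii0]; have [-> _] := aa' i ii0 ik.
move=> x x' xx'; rewrite /Phi !xx'//; try (by apply/eqP; lia).
congr (_ * (_ * _)); apply: eq_bigr => i /andP[ik ii0]; rewrite /edge.
by have [_ [? ?]] := aa' i ii0 ik; rewrite !xx'//; apply/eqP; lia.
Qed.

(** The product has no factor for k, so the edges k-1, ..., t can move up one after the other into
    the free slot. For t = 0 this frees the first vertex. *)
Lemma sum_edge_down (t : nat) : (t <= k)%N ->
  \sum_q \sum_s M (vtx q s k.+1) * \prod_(i | i != k) edge (vtx q s) i
     (if (t <= i < k)%N then i.+1 else i) =
  \sum_q \sum_s M (vtx q s k.+1) * \prod_(i | i != k) edge (vtx q s) i i.
Proof.
have kn := ltn_ord k.
move=> tk; have [d] := ubnP (k - t)%N; elim: d t tk => // d IH t tk kd.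
move: tk; rewrite leq_eqVlt => /orP[/eqP ->|tk].
  apply: eq_bigr => q _; apply: eq_bigr => s _; congr (_ * _).
  by apply: eq_bigr => i _; case: ifP => //; lia.
rewrite -(IH t.+1)//; last by lia.
have tn : (t < n)%N by lia.
symmetry; apply: (@sum_edge_shift _ _ _ (Ordinal tn)) => /=.
- by rewrite -val_eqE /=; lia.
- by case: ifP; lia.
- by case: ifP; case: ifP; lia.
- move=> i; rewrite -!val_eqE /= => it ik.
  by case: ifP; case: ifP; case: ifP; lia.
- by case: ifP; lia.
Qed.

(** Symmetrically, the edges k+1, ..., t-1 move down. For t = n this frees the last vertex. *)
Lemma sum_edge_up (t : nat) : (k < t <= n)%N ->
  \sum_q \sum_s M (vtx q s k) * \prod_(i | i != k) edge (vtx q s) i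
     (if (k < i < t)%N then i.-1 else i) =
  \sum_q \sum_s M (vtx q s k) * \prod_(i | i != k) edge (vtx q s) i i.
Proof.
have kn := ltn_ord k.
elim: t => // t IH /andP[]; rewrite ltnS leq_eqVlt => /orP[/eqP kt tn|kt tn].
  apply: eq_bigr => q _; apply: eq_bigr => s _; congr (_ * _).
  by apply: eq_bigr => i _; case: ifP => //; lia.
rewrite -IH ?kt 1?ltnW//.
apply: (@sum_edge_shift _ _ _ (Ordinal tn)) => /=.
- by rewrite -val_eqE /=; lia.
- by case: ifP; lia.
- by case: ifP; case: ifP; lia.
- move=> i; rewrite -!val_eqE /= => it ik.
  by case: ifP; case: ifP; case: ifP; lia.
- by case: ifP; lia.
Qed.

(** Discrete Stokes for dM in place of the k-th factor. After the shifts both sides sum the same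
    [Phi], over facets opposite to the first, resp. last, vertex, and [sum_vtx_rot] applies. On a
    boundary facet [Phi] is 0: either M vanishes there, or some [L i] is constant and its edge
    factor is 0. *)
Lemma sum_edge_vertex :
  \sum_q \sum_s M (vtx q s k.+1) * \prod_(i | i != k) edge (vtx q s) i i =
  \sum_q \sum_s M (vtx q s k) * \prod_(i | i != k) edge (vtx q s) i i.
Proof.
have kn := ltn_ord k; have n0 : (0 < n)%N by lia.
rewrite -(@sum_edge_down 0)// -(@sum_edge_up n); last by rewrite kn leqnn.
pose Phi (x : nat -> 'I_n -> nat) := M (x k) *
  \prod_(i | i != k) edge x i (if (k < i < n)%N then i.-1 else i).
have vanish i u x : i != k -> (forall y, y i = u -> L i y = L i (x 0%N)) ->
    (forall j, (j < n)%N -> x j i = u) -> Phi x = 0.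
  move=> ik Lu xu; rewrite /Phi (bigD1 i)//= /edge.
  rewrite !Lu ?addF2 ?mul0r ?mulr0//; apply: xu; have := ltn_ord i;
    by move: ik; rewrite -val_eqE /=; case: ifP; lia.
rewrite -[RHS](@sum_vtx_rot Phi)//.
- apply: eq_bigr => q _; apply: eq_bigr => s _; rewrite /Phi; congr (_ * _).
  apply: eq_bigr => i; rewrite -val_eqE /edge /= => ik; have := ltn_ord i.
  by case: ifP; case: ifP => ? ? ?;
    congr (L i (vtx q s _) + L i (vtx q s _)); lia.
- move=> x x' xx'; rewrite /Phi xx'//; congr (_ * _).
  apply: eq_bigr => i; rewrite -val_eqE /edge /= => ik; have := ltn_ord i => ?.
  by rewrite !xx'//; case: ifP; lia.
- move=> i x xi; have [ik|ik] := eqVneq i k.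
    by rewrite /Phi M0 ?mul0r// -ik; apply: xi; rewrite ik.
  by apply: (@vanish i 0%N) => // y yi; rewrite !L0// xi.
- move=> i x xi; have [ik|ik] := eqVneq i k.
    by rewrite /Phi M1 ?mul0r// -ik; apply: xi; rewrite ik.
  by apply: (@vanish i p) => // y yi; rewrite !L1// xi.
Qed.

End OneForm.

End FreudenthalGrid.

Arguments vtx {n p}.
Arguments edge {n}.
Arguments sum_edge_vertex {n p}.

Definition edge_sum {n : nat} (p : nat) (L : 'I_n -> ('I_n -> nat) -> 'F_2) :
    'F_2 :=
  \sum_(q : {ffun 'I_n -> 'I_p}) \sum_(s : 'S_n) \prod_i edge L (vtx q s) i i.

(** Modulo 2, the two sums add up to one whose k-th factor is the coboundary of [L k + L' k], which
    vanishes on both faces of direction k. *)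
Lemma edge_sum_replace (n p : nat) (k : 'I_n)
    (L L' : 'I_n -> ('I_n -> nat) -> 'F_2) :
  (forall i y, y i = 0%N -> L i y = 0) -> (forall i y, y i = p -> L i y = 1) ->
  (forall y, y k = 0%N -> L' k y = 0) -> (forall y, y k = p -> L' k y = 1) ->
  (forall i, i != k -> L' i = L i) ->
  edge_sum p L = edge_sum p L'.
Proof.
move=> L0 L1 L'0 L'1 LL'; apply: addF2_eq; rewrite /edge_sum -big_split /=.
under eq_bigr => q _ do rewrite -big_split /=.
pose M y := L k y + L' k y.
have M0 y : y k = 0%N -> M y = 0 by move=> yk; rewrite /M L0 ?L'0 ?addr0.
have M1 y : y k = p -> M y = 0 by move=> yk; rewrite /M L1 ?L'1 ?addF2.
have := sum_edge_vertex L k M (fun i y _ => @L0 i y)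
  (fun i y _ => @L1 i y) M0 M1.
move=> /(congr1 (fun z => z + \sum_(q : {ffun 'I_n -> 'I_p}) \sum_s
  M (vtx q s k) * \prod_(i | i != k) edge L (vtx q s) i i)).
rewrite addF2 -big_split /= => e; apply: etrans e; apply: eq_bigr => q _.
rewrite -big_split /=; apply: eq_bigr => s _.
rewrite (bigD1 k)//= [X in _ + X](bigD1 k)//= -mulrDl.
rewrite [X in _ + _ * X](eq_bigr (fun i => edge L (vtx q s) i i)).
  by rewrite -mulrDl; congr (_ * _); rewrite /edge /M; ring.
by move=> i ik; rewrite /edge LL'.
Qed.

Lemma edge_sum1 (n p : nat) (L : 'I_n -> ('I_n -> nat) -> 'F_2) :
  (0 < p)%N ->
  (forall i y, y i = 0%N -> L i y = 0) -> (forall i y, y i = p -> L i y = 1) ->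
  edge_sum p L = 1.
Proof.
move=> p0 L0 L1.
pose C (i : 'I_n) (y : 'I_n -> nat) : 'F_2 := (0 < y i)%N%:R.
(* Hybrid labelling: the first m labels are already replaced by the model [C]. *)
pose H (m : nat) (i : 'I_n) := if (i < m)%N then C i else L i.
have C0 (i : 'I_n) y : y i = 0%N -> C i y = 0 by rewrite /C => ->.
have C1 (i : 'I_n) y : y i = p -> C i y = 1 by rewrite /C => ->; rewrite p0.
have -> : edge_sum p L = edge_sum p (H n).
  have -> : L = H 0%N by apply/funext.
  suff E m : (m <= n)%N -> edge_sum p (H 0%N) = edge_sum p (H m) by apply: E.
  elim: m => // m IH mn; rewrite IH 1?ltnW//.
  apply: (@edge_sum_replace n p (Ordinal mn)).
  - by move=> i y yi; rewrite /H; case: ifP => _; rewrite ?C0 ?L0.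
  - by move=> i y yi; rewrite /H; case: ifP => _; rewrite ?C1 ?L1.
  - by move=> y yi; rewrite /H ltnSn C0.
  - by move=> y yi; rewrite /H ltnSn C1.
  - by move=> i; rewrite -val_eqE /= /H ltnS leq_eqVlt => /negPf ->.
(* For the model, coordinate i must start at 0 and rise along edge i exactly, so only the simplex
   with least vertex 0 and identity permutation contributes. *)
pose q0 : {ffun 'I_n -> 'I_p} := [ffun=> Ordinal p0].
rewrite /edge_sum (bigD1 q0)//= (bigD1 1%g)//=.
rewrite [X in _ + X + _]big1 1?[X in _ + _ + X]big1 ?addr0.
- apply: big1 => i _.
  by rewrite /edge /H ltn_ord /C /vtx ffunE perm1 /= ltnn ltnSn /= add0r.
- move=> q qq0; apply: big1 => s _; have [i qi] : exists i, q i != q0 i.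
    apply/existsP; rewrite -negb_forall; apply: contra qq0 => /forallP e.
    by apply/eqP/ffunP => i; apply/eqP; exact: e.
  have {}qi : (0 < q i)%N by move: qi; rewrite ffunE -val_eqE /= lt0n.
  by rewrite (bigD1 i)//= /edge /H ltn_ord /C /vtx !ltn_addr //= addF2 mul0r.
- move=> s s1; have [i si] : exists i, s i != i.
    apply/existsP; rewrite -negb_forall; apply: contra s1 => /forallP e.
    by apply/eqP/permP => i; rewrite perm1; apply/eqP; exact: e.
  rewrite (bigD1 i)//= /edge /H ltn_ord /C /vtx ffunE /= ltnS.
  by rewrite (leq_eqVlt (s i)) val_eqE (negPf si) /= addF2 mul0r.
Qed.

(** A nonzero [edge_sum] has a nonzero term, and in that simplex every label changes along one of
    the edges. *)
Lemma kuhn (n p : nat) (L : 'I_n -> ('I_n -> nat) -> bool) :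
  (0 < p)%N ->
  (forall i y, y i = 0%N -> L i y = false) ->
  (forall i y, y i = p -> L i y = true) ->
  exists q : 'I_n -> nat, (forall i, (q i < p)%N) /\
    forall i, exists y z : 'I_n -> nat,
      [/\ forall j, (q j <= y j <= (q j).+1)%N,
          forall j, (q j <= z j <= (q j).+1)%N, L i y = false & L i z = true].
Proof.
move=> p0 L0 L1; pose L' i y : 'F_2 := (L i y)%:R.
have : edge_sum p L' != 0.
  rewrite edge_sum1 ?oner_eq0//.
  - by move=> i y yi; rewrite /L' L0.
  - by move=> i y yi; rewrite /L' L1.
move=> S0; have [q qn0] : exists q : {ffun 'I_n -> 'I_p},
    \sum_(s : 'S_n) \prod_i edge L' (vtx q s) i i != 0.
  apply/existsP; rewrite -negb_forall; apply: contra S0 => /forallP e.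
  by apply/eqP/big1 => q _; apply/eqP/negbNE; rewrite negbK.
have [s sn0] : exists s : 'S_n, \prod_i edge L' (vtx q s) i i != 0.
  apply/existsP; rewrite -negb_forall; apply: contra qn0 => /forallP e.
  by apply/eqP/big1 => s _; apply/eqP/negbNE; rewrite negbK.
exists (fun i => q i); split=> // i.
have : edge L' (vtx q s) i i != 0.
  by apply: contra sn0 => /eqP e; rewrite (bigD1 i)//= e mul0r.
have bd j k : (q k <= vtx q s j k <= (q k).+1)%N.
  by rewrite /vtx; case: (_ < j)%N => /=; lia.
rewrite /edge /L'; case Ly: (L i _); case Lz: (L i _); rewrite ?addF2 ?eqxx// => _.
  by exists (vtx q s i.+1), (vtx q s i).
by exists (vtx q s i), (vtx q s i.+1).
Qed.

(** * The Poincare-Miranda theorem *)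

Lemma poincare_miranda (R : realType) (n : nat) (e : R)
    (F : 'I_n -> 'rV[R]_n -> R) :
  let K := [set t : 'rV[R]_n | forall i, - e <= t ord0 i <= e] in
  0 < e ->
  (forall i t, K t -> {for t, continuous (F i)}) ->
  (forall i t, K t -> t ord0 i = - e -> F i t < 0) ->
  (forall i t, K t -> t ord0 i = e -> 0 < F i t) ->
  exists2 t, K t & forall i, F i t = 0.
Proof.
move=> K e0 Fc Fl Fr.
(* The grid has N+1 subdivisions per side. The truncation by [minn] keeps every vector of naturals
   inside K, since labels are defined on all of them. *)
pose x N k : R := - e + (2 * e) * ((minn k N.+1)%:R / N.+1%:R).
have N0 N : 0 < N.+1%:R :> R by rewrite ltr0n.
have xK N k : - e <= x N k <= e.
  rewrite /x; set r := _ / _.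
  have r0 : 0 <= r by rewrite divr_ge0.
  have r1 : r <= 1 by rewrite ler_pdivrMr// mul1r ler_nat geq_minr.
  by apply/andP; split; nra.
pose pt N (y : 'I_n -> nat) : 'rV[R]_n := \row_i x N (y i).
have ptK N y : K (pt N y) by move=> i; rewrite mxE; exact: xK.
have kq N : exists q : 'I_n -> nat, forall i, exists y z : 'I_n -> nat,
    [/\ forall j, (q j <= y j <= (q j).+1)%N,
        forall j, (q j <= z j <= (q j).+1)%N,
        F i (pt N y) <= 0 & 0 < F i (pt N z)].
  have := @kuhn n N.+1 (fun i y => 0 < F i (pt N y)) isT.
  case=> [i y yi|i y yi|q [_ qP]].
  - apply/negbTE; rewrite -leNgt ltW// Fl// mxE /x yi min0n.
    by rewrite mul0r mulr0 addr0.
  - by apply: Fr => //; rewrite mxE /x yi minnn divff ?gt_eqF//; ring.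
  - exists q => i; have [y [z [qy qz /negbT Fy Fz]]] := qP i.
    by exists y, z; split=> //; rewrite leNgt.
have [q qP] := choice kq.
have closex N k l : (k <= l <= k.+1)%N -> `|x N k - x N l| <= (2 * e) / N.+1%:R.
  move=> kl; rewrite /x.
  have : ((minn k N.+1)%:R <= (minn l N.+1)%:R :> R) by rewrite ler_nat; lia.
  have : ((minn l N.+1)%:R <= (minn k N.+1)%:R + 1 :> R).
    by rewrite natr1 ler_nat; lia.
  set a := _%:R; set b := _%:R => ab ba.
  rewrite (_ : _ - _ = - ((2 * e) * ((a - b) / N.+1%:R))); last first.
    by field; rewrite nat1r gt_eqF.
  rewrite normrN ger0_norm; last first.
    by rewrite mulr_ge0 ?mulr_ge0 ?invr_ge0 ?subr_ge0// ltW.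
  by rewrite ler_pM2l; [rewrite -[leRHS]mul1r ler_pM2r ?invr_gt0//; lra|lra].
have Kcpt : compact K.
  rewrite (_ : K = [set t | forall i, `[- e, e]%classic (t ord0 i)]).
    apply: (@rV_compact R n (fun=> `[- e, e]%classic)) => i.
    exact: segment_compact.
  by apply/seteqP; split=> t tK i; have := tK i; rewrite /= in_itv.
pose t N := pt N (q N).
have tK : (t @ \oo) K by exists 0%N => // N _; exact: ptK.
have [s [Ks clus]] := Kcpt (t @ \oo) _ tK.
(* If [F i s] were nonzero, [F i] would keep its sign on a ball around s; but that ball contains a
   cell on which [F i] takes both signs. *)
exists s => // i; apply/eqP/negPn/negP => Fs.
have Fs0 : 0 < `|F i s| by rewrite normr_gt0.
have := Fc i s Ks; move=> /cvgrPdist_lt /(_ _ Fs0) /nbhs_ballP [d /= d0 sd].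
have d20 : 0 < d / 2 by rewrite divr_gt0.
have [N [NN0 sN]] : exists N, 2 * e / N.+1%:R < d / 2 /\ ball s (d / 2) (t N).
  have hN : \forall N \near \oo, 2 * e / N.+1%:R < d / 2.
    have : (fun N => 2 * e * (N.+1%:R)^-1) @ \oo --> (2 * e * 0 : R).
      by apply: cvgM; [exact: cvg_cst|exact: cvg_harmonic].
    rewrite mulr0 => /cvgrPdist_lt /(_ _ d20); apply: filterS => N.
    by rewrite sub0r normrN; apply: le_lt_trans; exact: ler_norm.
  have [] := clus [set t N | N in [set N | 2 * e / N.+1%:R < d / 2]]
      (ball s (d / 2)).
  - by apply: filterS hN => N /= h; exists N.
  - exact: nbhsx_ballx.
  - by move=> _ [[N /= h <-] b]; exists N.
have inball y : (forall j, (q N j <= y j <= (q N j).+1)%N) -> ball s d (pt N y).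
  move=> qy; split=> // a j; have := sN.2 a j; rewrite !mxE /ball /= => h1.
  have := closex N _ _ (qy j) => h2.
  rewrite (splitr d) (le_lt_trans (ler_distD (x N (q N j)) _ _))//.
  by rewrite ltrD// (le_lt_trans h2).
have [y [z [qy qz Fy Fz]]] := qP N i.
have := sd _ (inball _ qy); have := sd _ (inball _ qz) => /=.
rewrite !ltr_distlC; have [Fi|Fi] := ltP 0 (F i s).
  by rewrite (gtr0_norm Fi) => /andP[? ?] /andP[? ?]; lra.
by rewrite (ler0_norm Fi) => /andP[? ?] /andP[? ?]; lra.
Qed.

(** * Feasible points along bent directions *)

(** One real parameter per equality constraint: its negative part bends v towards [vs i], its
    positive part towards [ws i]. *)
Definition bend {R : realType} {X : normedModType R} {m : nat} (v : X)
    (vs ws : 'I_m -> X) (t : 'rV[R]_m) : X :=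
  v + \sum_i (Num.max 0 (- t ord0 i) *: vs i + Num.max 0 (t ord0 i) *: ws i).

Section Bend.
Variables (R : realType) (X : normedModType R) (m : nat).
Variables (v : X) (vs ws : 'I_m -> X).

Lemma bend0 : bend v vs ws 0 = v.
Proof.
rewrite /bend big1 ?addr0// => i _.
by rewrite mxE oppr0 maxxx !scale0r addr0.
Qed.

Lemma cvg_bend (F : set_system 'rV[R]_m) (t : 'rV[R]_m) : Filter F ->
  (forall i, s ord0 i @[s --> F] --> t ord0 i) ->
  bend v vs ws s @[s --> F] --> bend v vs ws t.
Proof.
move=> FF ct; rewrite /bend; apply: cvgD; first exact: cvg_cst.
apply: cvg_big => [|i _]; first exact: add_continuous.
have cmax (g : 'rV[R]_m -> R) (c : R) : g s @[s --> F] --> c ->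
    Num.max 0 (g s) @[s --> F] --> Num.max 0 c.
  have maxE (x : R) : Num.max 0 x = (x + `|x|) / 2.
    by rewrite maxr_absE add0r sub0r normrN.
  move=> gc; under eq_fun do rewrite maxE; rewrite maxE.
  apply: cvgM; last exact: cvg_cst.
  by apply: cvgD => //; apply: cvg_norm.
apply: cvgD; apply: cvgZr_tmp; apply: cmax; last exact: ct.
exact: cvgN (ct i).
Qed.

Lemma bend_continuous : continuous (bend v vs ws).
Proof.
move=> t; apply: (@cvg_bend (nbhs t)) => i; exact: coord_continuous.
Qed.

(** Any two bent directions differ by an element of the span of all [vs i] and [ws i], which is
    finite dimensional. *)
Lemma dir_diff_unif_bend (f : X -> R) (x : X) (t : 'rV[R]_m) (l eps : R) :
  dir_diff_unif f x -> ddir f x (bend v vs ws t) l -> 0 < eps ->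
  exists2 delta, 0 < delta & forall a s, 0 < a < delta ->
    `|bend v vs ws s - bend v vs ws t| < delta ->
    `|(f (x + a *: bend v vs ws s) - f x) / a - l| < eps.
Proof.
move=> [_ fu] fl eps0.
pose e (k : 'I_(m + m)) :=
  match fintype.split k with inl i => vs i | inr i => ws i end.
have [d d0 dP] := fu _ _ fl _ e _ eps0; exists d => // a s ad sd.
pose c (k : 'I_(m + m)) := match fintype.split k with
  | inl i => Num.max 0 (- s ord0 i) - Num.max 0 (- t ord0 i)
  | inr i => Num.max 0 (s ord0 i) - Num.max 0 (t ord0 i) end.
have E : \sum_k c k *: e k = bend v vs ws s - bend v vs ws t.
  rewrite /bend opprD addrACA subrr add0r -sumrB big_split_ord /=.
  rewrite -big_split /=; apply: eq_bigr => i _.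
  rewrite /c /e !(unsplitK (inl _ : 'I_m + 'I_m)%type).
  rewrite !(unsplitK (inr _ : 'I_m + 'I_m)%type).
  by rewrite !scalerBl opprD addrACA.
by have := dP a c ad; rewrite E subrKC => /(_ sd).
Qed.

End Bend.

Arguments bend0 {R X m}.
Arguments bend_continuous {R X m}.
Arguments dir_diff_unif_bend {R X m v vs ws f x t l eps}.

Lemma hadamard_dir_diff_lt0 {R : realType} {X : normedModType R} {f : X -> R}
    {x v : X} {l : R} :
  hadamard_dir_diff f x -> ddir f x v l -> l < 0 ->
  exists2 d, 0 < d & forall a w, 0 < a < d -> `|w - v| < d ->
    f (x + a *: w) < f x.
Proof.
move=> fH fl l0; have [l' fl'] := fH v.
(* Freezing the direction at v in the Hadamard limit gives the directional derivative. *)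
have el : l' = l.
  have h : (fun a : R => (a, v)) @ at_right 0 -->
      filter_prod (at_right (0 : R)) (nbhs v).
    move=> P [[A B] /= [hA hB] AB]; apply: filterS hA => a Aa.
    by apply: AB; split=> //=; exact: nbhs_singleton.
  have fl2 : (fun a => (f (x + a *: v) - f x) / a) @ at_right 0 --> l'.
    by move=> P /fl' /h.
  exact: norm_cvg_unique fl2 fl.
rewrite {}el in fl'.
have : \forall p \near filter_prod (at_right (0 : R)) (nbhs v),
    (f (x + p.1 *: p.2) - f x) / p.1 < 0.
  exact: (fl' _ (lt_nbhsl l0)).
case=> [[A B]] /= [A0 Bv] AB.
have [d1 /= d10 d1A] := A0; have /nbhs_ballP[d2 /= d20 d2B] := Bv.
exists (Num.min d1 d2); first by rewrite lt_min d10.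
move=> a w /andP[a0]; rewrite !lt_min => /andP[ad1 _] /andP[_ wd2].
have /= := AB (a, w); rewrite pmulr_llt0 ?invr_gt0// subr_lt0; apply.
split=> /=; last by apply: d2B; rewrite -ball_normE /= distrC.
by apply: d1A => //=; rewrite sub0r normrN gtr0_norm.
Qed.

Section Lyusternik.
Variables (R : realType) (X : normedModType R) (m l : nat).
Variables (f0 : X -> R) (f : 'I_m -> X -> R) (g : 'I_l -> X -> R) (xbar : X).
Variables (v : X) (vs ws : 'I_m -> X).
Let u := bend v vs ws.
Let K (e : R) := [set t : 'rV[R]_m | forall i, - e <= t ord0 i <= e].

Lemma bend_near (P : set X) : nbhs v P ->
  exists2 e, 0 < e & forall t, K e t -> P (u t).
Proof.
rewrite -(bend0 v vs ws) => /bend_continuous /nbhs_ballP [e /= e0 eP].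
exists (e / 2); first by rewrite divr_gt0.
move=> t Kt; apply: eP; split=> // i j; rewrite mxE /ball /= sub0r normrN.
rewrite (ord1 i); have /andP[a b] := Kt j; apply: (@le_lt_trans _ _ (e / 2)).
  by rewrite ler_norml a.
by rewrite ltr_pdivrMr// mulr_natr mulr2n ltrDl.
Qed.

Lemma bounded_steps_near (e : R) (P : set X) :
  (forall t, K e t -> `|u t - v| < 1) -> nbhs xbar P ->
  \forall a \near 0^'+, forall t, K e t -> P (xbar + a *: u t).
Proof.
move=> ub /nbhs_ballP [d /= d0 dP].
have vn : 0 < `|v| + 1 by rewrite ltr_wpDl.
have : 0 < d / (`|v| + 1) by rewrite divr_gt0.
move=> h; near=> a => t Kt; apply: dP.
have a0 : 0 < a by [].
rewrite -ball_normE /= opprD addrA subrr sub0r normrN normrZ gtr0_norm//.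
have ut : `|u t| < `|v| + 1.
  by rewrite -[u t](subrKC v) (le_lt_trans (ler_normD _ _))// ltrD2l ub.
apply: (@lt_trans _ _ (a * (`|v| + 1))); first by rewrite ltr_pM2l.
by rewrite -ltr_pdivlMr//; near: a; exact: nbhs_right_lt.
Unshelve. all: by end_near. Qed.

(** Each point of the face has a neighbourhood and a step bound on which the quotient keeps its
    sign; compactness of the face yields a common step bound. *)
Lemma face_sign (h : X -> R) (e : R) (i : 'I_m) (c sg : R) :
  `|sg| = 1 ->
  dir_diff_unif h xbar ->
  (forall t : 'rV[R]_m, t ord0 i = c ->
     forall r, ddir h xbar (u t) r -> 0 < sg * r) ->
  \forall a \near 0^'+, forall t, K e t -> t ord0 i = c ->
    0 < sg * ((h (xbar + a *: u t) - h xbar) / a).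
Proof.
move=> sg1 hu hc.
pose A (j : 'I_m) : set R := if j == i then [set c] else `[- e, e]%classic.
have Acpt : compact [set t : 'rV[R]_m | forall j, A j (t ord0 j)].
  apply: (@rV_compact R m A) => j; rewrite /A.
  by case: eqP => _; [exact: compact_set1|exact: segment_compact].
have /compact_near_coveringP cov := Acpt.
pose P a (t : 'rV[R]_m) :=
  0 < sg * ((h (xbar + a *: u t) - h xbar) / a).
have H : \forall a \near 0^'+,
    [set t : 'rV[R]_m | forall j, A j (t ord0 j)] `<=` P a.
  apply: cov => t At.
  have tc : t ord0 i = c by have := At i; rewrite /A eqxx.
  have [r hr] := hu.1 (u t).
  have r0 := hc _ tc _ hr.
  (* The tolerance is [sg * r], that is, the absolute value of the derivative itself. *)
  have [d d0 dP] := dir_diff_unif_bend hu hr r0.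
  have sB : \forall s \near t, `|u s - u t| < d.
    have := bend_continuous v vs ws t.
    move=> /cvgrPdist_lt /(_ _ d0); apply: filterS => s; by rewrite distrC.
  exists ([set s | `|u s - u t| < d], [set a | 0 < a < d]) => /=.
    split=> //; near=> a; apply/andP; split; first by [].
    by near: a; exact: nbhs_right_lt.
  move=> [s a] /= [sd ad]; have := dP a s ad sd.
  rewrite -[X in X < _]mul1r -sg1 -normrM mulrBr ltr_distl subrr.
  by move=> /andP[].
apply: filterS H => a H t Kt tc; apply: H => j; rewrite /A.
by have [->//|_] := eqVneq j i; rewrite /= in_itv; exact: Kt.
Unshelve. all: by end_near. Qed.


(** Otherwise f0 would decrease strictly along all small steps in directions near v, while
    Poincare-Miranda provides a feasible point among them. *)
Lemma ddir_objective_ge0 (l0 : R) :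
  (forall i, f i xbar = 0) -> (forall j, g j xbar <= 0) ->
  (\forall x \near xbar,
      (forall i, f i x = 0) -> (forall j, g j x <= 0) -> f0 xbar <= f0 x) ->
  hadamard_dir_diff f0 xbar ->
  (forall i, \forall y \near xbar, {for y, continuous (f i)}) ->
  (forall i, dir_diff_unif (f i) xbar) ->
  (forall j, g j xbar <> 0 -> usc_at (g j) xbar) ->
  (forall j, g j xbar = 0 -> dir_diff_unif (g j) xbar) ->
  (forall (t : 'rV[R]_m) i r, t ord0 i < 0 ->
     ddir (f i) xbar (u t) r -> r < 0) ->
  (forall (t : 'rV[R]_m) i r, 0 < t ord0 i ->
     ddir (f i) xbar (u t) r -> 0 < r) ->
  (forall j r, g j xbar = 0 -> ddir (g j) xbar v r -> r < 0) ->
  ddir f0 xbar v l0 -> 0 <= l0.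
Proof.
move=> fx gx opt f0H fcont fu gusc gu fneg fpos gneg f0l.
rewrite leNgt; apply/negP => l00.
have [d0 d00 d0P] := hadamard_dir_diff_lt0 f0H f0l l00.
have gact : \forall d \near 0^'+, forall j, g j xbar = 0 ->
    forall a t, 0 < a < d -> `|u t - v| < d -> g j (xbar + a *: u t) < 0.
  apply: filter_forall => j; have [gj|gj] := pselect (g j xbar = 0); last first.
    by apply: nearW.
  have [r hr] := (gu j gj).1 v; have r0 := gneg j r gj hr.
  have nr0 : 0 < - r by rewrite oppr_gt0.
  rewrite -(bend0 v vs ws) in hr.
  have [d d1 dP] := dir_diff_unif_bend (gu j gj) hr nr0.
  near=> e => _ a t /andP[a0 ae] te.
  have ed : e < d by near: e; exact: nbhs_right_lt.
  have := dP a t; rewrite a0 (lt_trans ae ed) bend0 (lt_trans te ed).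
  move=> /(_ isT isT); rewrite gj subr0 ltr_distl => /andP[_].
  by rewrite subrr pmulr_llt0 ?invr_gt0.
have /filter_ex [d [dg [d_gt0 [dd0 d1]]]] : \forall d \near 0^'+,
    (forall j, g j xbar = 0 -> forall a t, 0 < a < d -> `|u t - v| < d ->
       g j (xbar + a *: u t) < 0) /\ 0 < d /\ d < d0 /\ d < 1.
  near=> d; split; first by near: d.
  split; first by [].
  by split; near: d; exact: nbhs_right_lt.
have [e e0 eP] : exists2 e, 0 < e & forall t, K e t -> `|u t - v| < d.
  apply: (bend_near [set w | `|w - v| < d]).
  by apply/nbhs_ballP; exists d => //= w; rewrite -ball_normE /= distrC.
have uv1 t : K e t -> `|u t - v| < 1 by move=> /eP /lt_trans; apply.
(* A single step length a serves all parameters of the cube [K e]. The last two conditions are the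
   opposite signs on opposite faces. *)
have /filter_ex [a [a0 [ad [aopt [acont [ausc [aneg apos]]]]]]] :
  \forall a \near 0^'+, 0 < a /\ a < d /\
    (forall t, K e t -> (forall i, f i (xbar + a *: u t) = 0) ->
      (forall j, g j (xbar + a *: u t) <= 0) ->
      f0 xbar <= f0 (xbar + a *: u t)) /\
    (forall t, K e t -> forall i, {for xbar + a *: u t, continuous (f i)}) /\
    (forall t, K e t -> forall j, g j xbar <> 0 -> g j (xbar + a *: u t) < 0) /\
    (forall i t, K e t -> t ord0 i = - e ->
       0 < -1 * ((f i (xbar + a *: u t) - f i xbar) / a)) /\
    (forall i t, K e t -> t ord0 i = e ->
       0 < 1 * ((f i (xbar + a *: u t) - f i xbar) / a)).
  apply: filterI; first by near=> a.
  apply: filterI; first exact: nbhs_right_lt.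
  apply: filterI; first exact: bounded_steps_near uv1 opt.
  apply: filterI.
    apply: (bounded_steps_near e [set x | forall i, {for x, continuous (f i)}]
      uv1).
    exact: filter_forall.
  apply: filterI.
    apply: (bounded_steps_near e [set x | forall j, g j xbar <> 0 -> g j x < 0]
      uv1).
    apply: filter_forall => j.
    have [gj|gj] := pselect (g j xbar = 0); first exact: nearW.
    have gj0 : 0 < - g j xbar.
      by rewrite oppr_gt0 lt_neqAle gx andbT; apply/eqP.
    by have := gusc j gj _ gj0; apply: filterS => y; rewrite subrr.
  have Aneg i : \forall a \near 0^'+, forall t, K e t -> t ord0 i = - e ->
      0 < -1 * ((f i (xbar + a *: u t) - f i xbar) / a).
    apply: face_sign => //; first by rewrite normrN normr1.
    move=> t te r /fneg; rewrite te oppr_lt0 => /(_ e0) r0.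
    by rewrite mulN1r oppr_gt0.
  have Apos i : \forall a \near 0^'+, forall t, K e t -> t ord0 i = e ->
      0 < 1 * ((f i (xbar + a *: u t) - f i xbar) / a).
    apply: face_sign => //; first by rewrite normr1.
    by move=> t te r /fpos; rewrite te => /(_ e0); rewrite mul1r.
  by apply: filterI; [exact: (filter_forall _ Aneg)|exact: (filter_forall _ Apos)].
have [|||t Kt ft] := poincare_miranda R m e
    (fun i t => f i (xbar + a *: u t)) e0.
- move=> i t Kt.
  have hc : {for t, continuous (fun t => xbar + a *: u t)}.
    have hF (F : set_system 'rV[R]_m) : Filter F -> u s @[s --> F] --> u t ->
        xbar + a *: u s @[s --> F] --> xbar + a *: u t.
      by move=> FF us; apply: cvgD; [exact: cvg_cst|exact: cvgZl_tmp].
    exact: (hF (nbhs t) _ (bend_continuous v vs ws t)).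
  exact: (continuous_comp hc (acont t Kt i)).
- move=> i t Kt te; have := aneg i t Kt te.
  by rewrite fx subr0 mulN1r oppr_gt0 pmulr_llt0 ?invr_gt0.
- move=> i t Kt te; have := apos i t Kt te.
  by rewrite fx subr0 mul1r pmulr_lgt0 ?invr_gt0.
have : f0 xbar <= f0 (xbar + a *: u t).
  apply: aopt => // j; have [gj|gj] := pselect (g j xbar = 0).
    by apply/ltW/dg => //; [rewrite a0|exact: eP].
  exact/ltW/ausc.
rewrite leNgt d0P//; first by rewrite a0 (lt_trans ad).
exact: lt_trans (eP _ Kt) dd0.
Unshelve. all: by end_near. Qed.

End Lyusternik.

(** * Separation in the weak* topology *)

Lemma ptws_nbhsP {R : realType} {X : normedModType R} (h : X -> R)
    (U : set (X -> R)) :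
  nbhs (h : ptws_fun X) U <-> exists (s : seq X) (e : R), 0 < e /\
    [set w | forall x, x \in s -> `|w x - h x| < e] `<=` U.
Proof.
split=> [hU|[s [e [e0 sU]]]].
  pose B (p : seq X * R) :=
    [set w : X -> R | forall x, x \in p.1 -> `|w x - h x| < p.2].
  (* The filter generated by the basic sets converges pointwise to h, hence contains every
     neighbourhood of h. *)
  have FB : Filter (filter_from [set p | 0 < p.2] B).
    apply: filter_from_filter; first by exists ([::], 1) => /=.
    move=> [s1 e1] [s2 e2] /= h1 h2; exists (s1 ++ s2, Num.min e1 e2) => /=.
      by rewrite lt_min h1.
    move=> w /= wP; split=> x /= xs; have := wP x; rewrite mem_cat xs ?orbT.
      by move=> /(_ isT); rewrite lt_min => /andP[].
    by move=> /(_ isT); rewrite lt_min => /andP[].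
  have : {ptws, filter_from [set p | 0 < p.2] B --> h}.
    apply/pointwise_cvgP => t; apply/cvgrPdist_lt => e e0.
    by exists ([:: t], e) => //= w; rewrite distrC; apply; rewrite mem_head.
  by move=> /(_ _ hU) [[s e] /= e0 sU]; exists s, e.
have ch : {ptws, nbhs (h : ptws_fun X) --> h} by [].
have gen (F : set_system (X -> R)) : Filter F ->
    (forall x, w x @[w --> F] --> h x) ->
    F [set w | forall x, x \in s -> `|w x - h x| < e].
  move=> FF Fh; elim: s {sU} => [|x s IH]; first by apply: nearW.
  have /cvgrPdist_lt /(_ e e0) hx := Fh x.
  apply: filterS2 IH hx => w ws wx y; rewrite in_cons => /orP[/eqP ->|/ws//].
  by rewrite distrC.
have nF : Filter (nbhs (h : ptws_fun X)) by exact: nbhs_filter.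
exact: (@filterS _ _ nF _ _ sU (gen _ nF ((pointwise_cvgP _ _).1 ch))).
Qed.

Definition dot {R : realType} {r : nat} (y z : 'rV[R]_r) : R :=
  \sum_i y ord0 i * z ord0 i.

Lemma cvg_dot {R : realType} {r : nat} (y z : 'rV[R]_r)
    (F : set_system 'rV[R]_r) (f g : 'rV[R]_r -> 'rV[R]_r) : Filter F ->
  f t @[t --> F] --> y -> g t @[t --> F] --> z ->
  dot (f t) (g t) @[t --> F] --> dot y z.
Proof.
move=> FF fy gz; apply: cvg_big => [|i _]; first exact: add_continuous.
have cc (w : 'rV[R]_r) : (fun s : 'rV[R]_r => s ord0 i) @ w --> w ord0 i.
  exact: coord_continuous.
by apply: cvgM => P /cc; [move/fy|move/gz].
Qed.

Lemma dotDl {R : realType} {r : nat} (a : R) (x y z : 'rV[R]_r) :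
  dot (a *: x + y) z = a * dot x z + dot y z.
Proof.
by rewrite /dot mulr_sumr -big_split; apply: eq_bigr => i _; rewrite !mxE /=; ring.
Qed.

Lemma dotC {R : realType} {r : nat} (y z : 'rV[R]_r) : dot y z = dot z y.
Proof. by apply: eq_bigr => i _; rewrite mulrC. Qed.

Lemma dot_ge_sqr {R : realType} {r : nat} (y : 'rV[R]_r) i :
  y ord0 i ^+ 2 <= dot y y.
Proof.
rewrite /dot (bigD1 i)//= expr2 lerDl sumr_ge0// => j _.
by rewrite -expr2 sqr_ge0.
Qed.

(** The point of least Euclidean norm in the closure of Q is nonzero, because Q avoids a box around
    0, and it defines the separating functional. *)
Lemma separation_away_from0 {R : realType} {r : nat} (Q : set 'rV[R]_r) (e : R) :
  0 < e -> Q !=set0 ->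
  (forall y z t, Q y -> Q z -> 0 <= t <= 1 -> Q (t *: y + (1 - t) *: z)) ->
  (forall y, Q y -> exists i, e <= `|y ord0 i|) ->
  exists xi, forall y, Q y -> 0 < dot xi y.
Proof.
move=> e0 [y1 Qy1] Qcvx Qe.
(* Points of norm at most that of y1 lie in the box of half-width B, so the minimum is sought on a
   compact set. *)
pose B := dot y1 y1 + 1.
have box (z : 'rV[R]_r) i : dot z z <= dot y1 y1 -> - B <= z ord0 i <= B.
  move=> zz; have := le_trans (dot_ge_sqr z i) zz; rewrite /B => h.
  by apply/andP; split; nra.
pose A := closure Q `&` [set y | forall i, `[- B, B]%classic (y ord0 i)].
have Ac : compact A.
  rewrite /A setIC; apply: compact_closedI; last exact: closed_closure.
  apply: (@rV_compact R r (fun=> `[- B, B]%classic)) => i.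
  exact: segment_compact.
have A1 : A !=set0.
  exists y1; split; first exact: subset_closure.
  by move=> i; rewrite /= in_itv /= box.
have [y0 Ay0 y0min] : exists2 c, c \in A & forall t, t \in A ->
    dot c c <= dot t t.
  apply: (@EVT_min_rV R r (fun t => dot t t) A A1 Ac).
  apply: continuous_subspaceT => t; apply: (@cvg_dot R r t t (nbhs t) id id);
    exact: cvg_id.
have {}Ay0 := set_mem Ay0.
have y0le z : closure Q z -> dot y0 y0 <= dot z z.
  move=> Qz; have [zz|zz] := leP (dot z z) (dot y1 y1).
    by apply/y0min/mem_set; split=> // i; rewrite /= in_itv /= box.
  apply: le_trans (ltW zz); apply/y0min/mem_set; split.
    exact: subset_closure.
  by move=> i; rewrite /= in_itv /= box.
have y00 : 0 < dot y0 y0.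
  rewrite lt_neqAle sumr_ge0 ?andbT; last first.
    by move=> i _; rewrite -expr2 sqr_ge0.
  apply/eqP => d0.
  have y0E : y0 = 0.
    apply/rowP => i; rewrite mxE; have := dot_ge_sqr y0 i.
    by rewrite -d0 => h; apply/eqP; rewrite -sqrf_eq0 eq_le h sqr_ge0.
  have := Ay0.1 (ball 0 e); rewrite y0E => /(_ (nbhsx_ballx _ _ e0)).
  move=> [z [Qz [_ zb]]]; have [i ei] := Qe z Qz.
  have := zb ord0 i; rewrite mxE /ball /= sub0r normrN.
  by rewrite ltNge ei.
exists y0 => y Qy; apply: lt_le_trans y00 _.
have segQ t : 0 <= t <= 1 -> closure Q (t *: (y - y0) + y0).
  move=> t01.
  have -> : t *: (y - y0) + y0 = t *: y + (1 - t) *: y0.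
    by rewrite scalerBr scalerBl scale1r -addrA [- _ + _]addrC.
  have hc : (fun z => t *: y + (1 - t) *: z) @ nbhs y0 -->
      t *: y + (1 - t) *: y0.
    by apply: cvgD; [exact: cvg_cst|apply: cvgZl_tmp; exact: cvg_id].
  move=> N /hc hN; have [z [Qz Nz]] := Ay0.1 _ hN.
  by exists (t *: y + (1 - t) *: z); split=> //; exact: Qcvx.
pose a := dot y0 (y - y0); pose b := dot (y - y0) (y - y0).
have b0 : 0 <= b by apply: sumr_ge0 => i _; rewrite -expr2 sqr_ge0.
have quad t : 0 <= t <= 1 -> 0 <= t * (2 * a + t * b).
  move=> t01; have := y0le _ (segQ t t01).
  rewrite dotDl dotC dotDl [X in _ + X]dotC dotDl -/b.
  rewrite [dot (y - y0) y0]dotC -/a => h; lra.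
have -> : dot y0 y = dot y0 y0 + a.
  by rewrite /a /dot -big_split; apply: eq_bigr => i _; rewrite !mxE /=; ring.
rewrite lerDl leNgt; apply/negP => a0.
have ba : 0 < b - a by lra.
(* If a < 0, this t lies in the unit interval and makes 2a + tb negative, contradicting [quad]; the
   denominator b - a is positive even when b = 0. *)
have t01 : 0 <= - a / (b - a) <= 1.
  by apply/andP; split; [apply: divr_ge0; lra|rewrite ler_pdivrMr//; lra].
have := quad _ t01; rewrite pmulr_rge0; last by rewrite divr_gt0//; lra.
have -> : 2 * a + - a / (b - a) * b = a * (b - 2 * a) / (b - a).
  by field; rewrite gt_eqF.
rewrite pmulr_lge0 ?invr_gt0//; nra.
Qed.

Section Dual.
Variables (R : realType) (X : normedModType R).
Implicit Types (h : X -> R).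

Lemma dual_lin h a x y : dual h -> h (a *: x + y) = a * h x + h y.
Proof. by case=> + _; apply. Qed.

Lemma dual0 h : dual h -> h 0 = 0.
Proof.
move=> dh; have := dual_lin h 1 0 0 dh.
by rewrite scaler0 addr0 mul1r => e; apply: (@addrI _ (h 0)); rewrite -e addr0.
Qed.

Lemma dualZ h a x : dual h -> h (a *: x) = a * h x.
Proof. by move=> dh; rewrite -[a *: x]addr0 dual_lin// dual0// addr0. Qed.

Lemma dualD h x y : dual h -> h (x + y) = h x + h y.
Proof. by move=> dh; rewrite -{1}[x]scale1r dual_lin// mul1r. Qed.

Lemma dual_sum h n (x : 'I_n -> X) :
  dual h -> h (\sum_i x i) = \sum_i h (x i).
Proof.
by move=> dh; apply: (big_morph h) => [y z|]; [exact: dualD|exact: dual0].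
Qed.

End Dual.

Arguments dual_lin {R X h}.
Arguments dualD {R X h x y}.
Arguments dualZ {R X h a x}.

Section Cone.
Variables (R : realType) (X : normedModType R) (I : Type).
Variable F : I -> set (X -> R).

Lemma cone_fam0 : cone_fam F (fun=> 0).
Proof.
exists 0%N, (fun=> 0), (fun=> fun=> 0); split; first by case.
by split; [case|apply/funext => x; rewrite big_ord0].
Qed.

Lemma cone_fam_ray i c (t : R) : F i c -> 0 <= t -> cone_fam F (fun x => t * c x).
Proof.
move=> Fc t0; exists 1%N, (fun=> t), (fun=> c); split=> //.
by split; [move=> _; exists i|apply/funext => x; rewrite big_ord1].
Qed.

Lemma cone_fam_comb h1 h2 (a b : R) : cone_fam F h1 -> cone_fam F h2 ->
  0 <= a -> 0 <= b -> cone_fam F (fun x => a * h1 x + b * h2 x).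
Proof.
move=> [n1 [c1 [g1 [c10 [Fg1 ->]]]]] [n2 [c2 [g2 [c20 [Fg2 ->]]]]] a0 b0.
exists (n1 + n2)%N,
  (fun k => match fintype.split k with inl i => a * c1 i | inr i => b * c2 i end),
  (fun k => match fintype.split k with inl i => g1 i | inr i => g2 i end).
split; first by move=> k; case: fintype.split => i; rewrite mulr_ge0.
split; first by move=> k; case: fintype.split => i.
apply/funext => x; rewrite big_split_ord !mulr_sumr /=.
congr (_ + _); apply: eq_bigr => i _.
  by rewrite !(unsplitK (inl _ : 'I_n1 + 'I_n2)%type) mulrA.
by rewrite !(unsplitK (inr _ : 'I_n1 + 'I_n2)%type) mulrA.
Qed.

End Cone.

Arguments cone_fam0 {R X I}.
Arguments cone_fam_ray {R X I F i c t}.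

(* convex_set is qualified because MathComp-Analysis exports another constant of
   that name. *)
Lemma cone_alternative {R : realType} {X : normedModType R} {I : Type}
    (F : I -> set (X -> R)) (D : set (X -> R)) :
  Defs.convex_set D -> wstar_compact D -> D !=set0 ->
  (forall i, F i `<=` @dual R X) ->
  (forall x, (forall i c, F i c -> c x <= 0) -> exists2 d, D d & 0 <= d x) ->
  exists2 d, D d & closure (cone_fam F : set (ptws_fun X)) (fun x => - d x).
Proof.
move=> Dcvx [Ddual Dcpt] [d1 Dd1] Fdual DF.
(* On finitely many points, D plus the cone comes arbitrarily close to 0; otherwise the vectors of
   its values form a convex set away from the origin, and are separated from it. *)
have approx (s : seq X) (e : R) : 0 < e ->
    exists2 d, D d & exists2 p, cone_fam F p &
      forall x, x \in s -> `|d x + p x| < e.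
  move=> e0; apply: contrapT => none.
  pose r := size s; pose y (i : 'I_r) := tnth (in_tuple s) i.
  pose Q := [set z : 'rV[R]_r | exists2 d, D d & exists2 p, cone_fam F p &
    z = \row_i (d (y i) + p (y i))].
  have [||||xi xiP] := @separation_away_from0 R r Q e.
  - exact: e0.
  - exists (\row_i (d1 (y i) + 0)), d1 => //.
    by exists (fun=> 0); first exact: cone_fam0.
  - move=> _ _ t [d Dd [p Pp ->]] [d' Dd' [p' Pp' ->]] t01.
    exists (fun x => t * d x + (1 - t) * d' x); first exact: Dcvx.
    exists (fun x => t * p x + (1 - t) * p' x).
      by have /andP[? ?] := t01; apply: cone_fam_comb => //; rewrite subr_ge0.
    by apply/rowP => i; rewrite !mxE; ring.
  - move=> _ [d Dd [p Pp ->]]; apply: contrapT => small; apply: none.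
    exists d => //; exists p => // x /seq_tnthP [i ->].
    rewrite ltNge; apply/negP => ei; apply: small.
    by exists i; rewrite mxE.
  (* The separating vector is realized as a point of X: evaluation at x is minus the pairing with
     xi. *)
  pose x := - \sum_i xi ord0 i *: y i.
  have xE h : dual h -> h x = - \sum_i xi ord0 i * h (y i).
    move=> dh; rewrite /x -scaleN1r dualZ// mulN1r dual_sum//; congr (- _).
    by apply: eq_bigr => i _; rewrite dualZ.
  have neg d p : D d -> cone_fam F p -> dual p ->
      d x + p x < 0.
    move=> Dd Pp dp.
    rewrite !xE//; last exact: Ddual.
    rewrite -opprD oppr_lt0 -big_split /=.
    rewrite (_ : \sum_i _ = dot xi (\row_i (d (y i) + p (y i)))).
      by apply: xiP; exists d => //; exists p.
    by apply: eq_bigr => i _; rewrite mxE mulrDr.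
  have zdual : @dual R X (fun=> 0).
    by split; [move=> *; rewrite mulr0 addr0|exact: cst_continuous].
  have [i c Fc|d Dd] := DF x.
    rewrite leNgt; apply/negP => cx0.
    have dc := Fdual i c Fc.
    (* This multiple of c takes the value [|d1 x|] at x, which outweighs a negative [d1 x]. *)
    pose t := `|d1 x| / c x.
    have t0 : 0 <= t by rewrite divr_ge0// ltW.
    have := neg d1 (fun z => t * c z) Dd1 (cone_fam_ray Fc t0).
    rewrite /t mulfVK ?gt_eqF// => h.
    have : d1 x + `|d1 x| < 0.
      apply: h; split.
        by move=> a z w; rewrite dual_lin//; ring.
      move=> z; apply: cvgM; [exact: cvg_cst|exact: dc.2].
    by rewrite ltNge -lerBlDl sub0r -normrN ler_norm.
  rewrite leNgt => /negP; apply.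
  by have := neg d (fun=> 0) Dd (cone_fam0 F) zdual; rewrite addr0.
(* The approximate solutions in D form a filter base; a cluster point in the compact D is an exact
   solution. *)
pose G (k : seq X * R) := [set d | D d /\ exists2 p, cone_fam F p &
  forall x, x \in k.1 -> `|d x + p x| < k.2].
have GF : ProperFilter (filter_from [set k | 0 < k.2] G).
  apply: filter_from_proper.
    apply: filter_from_filter; first by exists ([::], 1) => /=.
    move=> [s1 e1] [s2 e2] /= h1 h2; exists (s1 ++ s2, Num.min e1 e2) => /=.
      by rewrite lt_min h1.
    move=> d [Dd [p Pp dp]]; split; split=> //; exists p => // x xs.
      by have := dp x; rewrite /= mem_cat xs lt_min => /(_ isT) /andP[].
    by have := dp x; rewrite /= mem_cat xs orbT lt_min => /(_ isT) /andP[].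
  move=> [s e] /= e0; have [d Dd [p Pp dp]] := approx s e e0.
  by exists d; split=> //; exists p.
have [|d [Dd clus]] := Dcpt _ GF.
  by exists ([::], 1) => //= d [].
exists d => // N /ptws_nbhsP [s [e [e0 sN]]].
have e20 : 0 < e / 2 by rewrite divr_gt0.
have [||d' [[_ [p Pp dp]] dd']] := clus (G (s, e / 2))
    [set w | forall x, x \in s -> `|w x - d x| < e / 2].
- by exists (s, e / 2) => /=.
- by apply/ptws_nbhsP; exists s, (e / 2); split.
exists p; split=> //; apply: sN => x xs; rewrite opprK.
have -> : p x + d x = (d' x + p x) - (d' x - d x) by ring.
rewrite (splitr e) (le_lt_trans (ler_normB _ _))// ltrD//.
  exact: dp.
exact: dd'.
Qed.

(** * Weak* compact convex sets of Lagrangians *)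

Section WeakStarCompact.
Variables (R : realType) (X : normedModType R).
Implicit Types (A B C D : set (X -> R)) (h : X -> R).

Lemma dual_add h1 h2 : dual h1 -> dual h2 -> @dual R X (fun x => h1 x + h2 x).
Proof.
move=> d1 d2; split; first move=> a x y.
  by rewrite (dual_lin _ _ _ d1) (dual_lin _ _ _ d2); ring.
by move=> x; apply: cvgD; [exact: d1.2|exact: d2.2].
Qed.

Lemma dual_scale h (t : R) : dual h -> @dual R X (fun x => t * h x).
Proof.
move=> dh; split; first by move=> a x y; rewrite (dual_lin _ _ _ dh); ring.
by move=> x; apply: cvgM; [exact: cvg_cst|exact: dh.2].
Qed.

Lemma dual_opp h : dual h -> @dual R X (fun x => - h x).
Proof.
move=> dh; split; first by move=> a x y; rewrite (dual_lin _ _ _ dh); ring.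
by move=> x; apply: cvgN; exact: dh.2.
Qed.

Lemma ptws_continuous (T : topologicalType) (phi : T -> ptws_fun X) :
  (forall x, continuous (fun t => phi t x)) -> continuous phi.
Proof.
move=> phic t; apply/pointwise_cvgP => x; exact: phic.
Qed.

Lemma ptws_eval_continuous (x : X) : continuous (fun h : ptws_fun X => h x).
Proof.
move=> h; have ch : {ptws, nbhs (h : ptws_fun X) --> h} by [].
exact: (pointwise_cvgP _ _).1 ch x.
Qed.

Lemma wstar_compact_max C x : wstar_compact C -> C !=set0 ->
  exists2 a, C a & forall c, C c -> c x <= a x.
Proof.
move=> [_ Cc] C0.
have [|a Ca amax] := @compact_EVT_max (ptws_fun X) R (fun h => h x) C C0 Cc.
  exact/continuous_subspaceT/ptws_eval_continuous.
by exists a; [exact: set_mem|move=> c Cc'; exact/amax/mem_set].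
Qed.

Lemma transl_compact C h : wstar_compact C -> dual h -> wstar_compact (transl C h).
Proof.
move=> [Cd Cc] dh; split.
  by move=> _ [a Ca [_ -> ->]]; apply: dual_add => //; exact: Cd.
rewrite (_ : transl C h =
  (fun (c : ptws_fun X) => (fun x => c x + h x) : ptws_fun X) @` C).
  apply: continuous_compact Cc; apply: continuous_subspaceT.
  apply: ptws_continuous => x c.
  have gen (F : set_system (X -> R)) : Filter F -> b x @[b --> F] --> c x ->
      (b x + h x) @[b --> F] --> c x + h x.
    by move=> FF bc; apply: cvgD => //; exact: cvg_cst.
  by apply: (gen (nbhs c)); exact: ptws_eval_continuous.
apply/seteqP; split=> [_ [a Ca [_ -> ->]]|_ [a Ca <-]]; first by exists a.
by exists a => //; exists h.
Qed.

Lemma transl_convex C h : Defs.convex_set C -> Defs.convex_set (transl C h).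
Proof.
move=> Cc _ _ t [a Ca [_ -> ->]] [b Cb [_ -> ->]] t01.
exists (fun x => t * a x + (1 - t) * b x); first exact: Cc.
by exists h => //; apply/funext => x; ring.
Qed.

Definition add_segment D B (L : R) : set (X -> R) :=
  [set h | exists2 d, D d & exists2 t, 0 <= t <= L & exists2 b, B b &
     h = (fun x => d x + t * b x)].

(** A combination of t b and t' b' is s times a convex combination of b and b', where s is the same
    combination of t and t'. When s = 0 both terms vanish and any element of B serves. *)
Lemma add_segment_convex D B L : Defs.convex_set D -> Defs.convex_set B ->
  Defs.convex_set (add_segment D B L).
Proof.
move=> Dc Bc _ _ w [d Dd [t tL [b Bb ->]]] [d' Dd' [t' tL' [b' Bb' ->]]] w01.
have /andP[t0 tl] := tL; have /andP[t0' tl'] := tL'; have /andP[w0 w1] := w01.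
exists (fun x => w * d x + (1 - w) * d' x); first exact: Dc.
have p1 : 0 <= w * t by rewrite mulr_ge0.
have p2 : 0 <= (1 - w) * t' by rewrite mulr_ge0// subr_ge0.
exists (w * t + (1 - w) * t'); first by apply/andP; split; nra.
set s := w * t + (1 - w) * t'.
have [s0|s0] := eqVneq s 0.
  have wt : w * t = 0 by apply/eqP; rewrite eq_le p1 andbT; rewrite /s in s0; lra.
  have wt' : (1 - w) * t' = 0.
    by apply/eqP; rewrite eq_le p2 andbT; rewrite /s in s0; lra.
  exists b => //; apply/funext => x; rewrite s0 mul0r addr0.
  have -> : w * (d x + t * b x) + (1 - w) * (d' x + t' * b' x) =
    w * d x + (1 - w) * d' x + (w * t * b x + (1 - w) * t' * b' x) by ring.
  by rewrite wt wt' !mul0r !addr0.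
have sp : 0 < s by rewrite lt_neqAle eq_sym s0 /s addr_ge0.
exists (fun x => (w * t / s) * b x + (1 - w * t / s) * b' x).
  apply: Bc => //; apply/andP; split; first by rewrite divr_ge0// ltW.
  by rewrite ler_pdivrMr// mul1r /s; lra.
by apply/funext => x; rewrite /s; field.
Qed.

Lemma add_segment_compact D B L : wstar_compact D -> wstar_compact B ->
  wstar_compact (add_segment D B L).
Proof.
move=> [Dd Dc] [Bd Bc]; split.
  move=> _ [d Dd' [t _ [b Bb ->]]].
  by apply: dual_add; [exact: Dd|apply: dual_scale; exact: Bd].
pose phi (p : ptws_fun X * R * ptws_fun X) : ptws_fun X :=
  fun x => p.1.1 x + p.1.2 * p.2 x.
rewrite (_ : add_segment D B L = phi @` (D `*` `[0, L]%classic `*` B)).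
  have := compact_setX (compact_setX Dc (@segment_compact R 0 L)) Bc.
  apply: continuous_compact.
  apply: continuous_subspaceT; apply: ptws_continuous => x p.
  have gen (F : set_system (ptws_fun X * R * ptws_fun X)) : Filter F ->
      q.1.1 x @[q --> F] --> p.1.1 x -> q.1.2 @[q --> F] --> p.1.2 ->
      q.2 x @[q --> F] --> p.2 x -> phi q x @[q --> F] --> phi p x.
    by move=> FF c1 c2 c3; apply: cvgD => //; apply: cvgM.
  have eval1 : q.1.1 x @[q --> p] --> p.1.1 x.
    move=> N /ptws_eval_continuous hN.
    have N1 : nbhs p.1 [set q : ptws_fun X * R | N (q.1 x)].
      exists ([set h : ptws_fun X | N (h x)], setT); last by move=> ? [].
      by split; [exact: hN|exact: filterT].
    exists ([set q | N (q.1 x)], setT); last by move=> ? [].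
    by split; [exact: N1|exact: filterT].
  have eval2 : q.2 x @[q --> p] --> p.2 x.
    move=> N /ptws_eval_continuous hN.
    exists (setT, [set h : ptws_fun X | N (h x)]); last by move=> ? [].
    by split; [exact: filterT|exact: hN].
  have eval12 : q.1.2 @[q --> p] --> p.1.2.
    move=> N hN.
    have N1 : nbhs p.1 [set q : ptws_fun X * R | N q.2].
      exists (setT, N); last by move=> ? [].
      by split; [exact: filterT|exact: hN].
    exists ([set q | N q.2], setT); last by move=> ? [].
    by split; [exact: N1|exact: filterT].
  by apply: (gen (nbhs p)).
apply/seteqP; split=> [_ [d Dd' [t tL [b Bb ->]]]|_ [[[d t] b] [[Dd' tL] Bb] <-]].
  by exists ((d, t), b) => //; split=> //; split=> //=; rewrite in_itv.
by exists d => //; exists t; [move: tL; rewrite /= in_itv|exists b].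
Qed.

Section Lagrangian.
Variables (l : nat) (A : set (X -> R)) (B : 'I_l -> set (X -> R)) (L : 'I_l -> R).

(** Indexing by a list allows the terms to be added one at a time through [add_segment]. *)
Definition lagrangian (s : seq 'I_l) : set (X -> R) :=
  [set h | exists a lam b, [/\ A a, forall j, 0 <= lam j <= L j,
     forall j, B j (b j) & h = (fun x => a x + \sum_(j <- s) lam j * b j x)]].

Hypothesis B0 : forall j, B j !=set0.
Hypothesis L0 : forall j, 0 <= L j.

Lemma lagrangian_nil : lagrangian [::] = A.
Proof.
apply/seteqP; split=> [_ [a [lam [b [Aa _ _ ->]]]]|a Aa].
  by under eq_fun do rewrite big_nil addr0.
have [b Bb] := choice B0.
exists a, (fun=> 0), b; split=> // [j|]; first by rewrite lexx L0.
by apply/funext => x; rewrite big_nil addr0.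
Qed.

Lemma lagrangian_cons j s : j \notin s ->
  lagrangian (j :: s) = add_segment (lagrangian s) (B j) (L j).
Proof.
move=> js; apply/seteqP; split=> [_ [a [lam [b [Aa lamL Bb ->]]]]|].
  exists (fun x => a x + \sum_(i <- s) lam i * b i x); first by exists a, lam, b.
  exists (lam j) => //; exists (b j) => //.
  by apply/funext => x; rewrite big_cons; ring.
move=> _ [_ [a [lam [b [Aa lamL Bb ->]]]] [t tL [c Bc ->]]].
exists a, (fun i => if i == j then t else lam i),
  (fun i => if i == j then c else b i); split=> //.
- by move=> i; case: eqP => [->|].
- by move=> i; case: eqP => [->|].
apply/funext => x; rewrite big_cons eqxx.
rewrite [in RHS](eq_big_seq (fun i => lam i * b i x)); first ring.
by move=> i si /=; case: eqP => // ij; rewrite -ij si in js.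
Qed.

Lemma lagrangian_compact_convex s : uniq s ->
  Defs.convex_set A -> wstar_compact A ->
  (forall j, Defs.convex_set (B j)) -> (forall j, wstar_compact (B j)) ->
  Defs.convex_set (lagrangian s) /\ wstar_compact (lagrangian s).
Proof.
move=> + Ac Aw Bc Bw; elim: s => [_|j s IH]; first by rewrite lagrangian_nil.
move=> /= /andP[js /IH[IH1 IH2]]; rewrite lagrangian_cons//.
by split; [exact: add_segment_convex|exact: add_segment_compact].
Qed.

End Lagrangian.

End WeakStarCompact.

Arguments lagrangian {R X l}.
Arguments wstar_compact_max {R X C}.
Arguments lagrangian_compact_convex {R X l A B L}.
Arguments dual_opp {R X h}.
Arguments dual_add {R X h1 h2}.

(** * Multipliers *)

(** [cone_alternative] is applied to the Lagrangians with multipliers at most [L j]; its hypothesis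
    follows from the optimality condition by moving along [v0]. The bound is 0 for inactive j,
    whence complementarity. *)
Lemma lagrange_multipliers {R : realType} {X : normedModType R} {l : nat}
    {I : Type} (A : set (X -> R)) (B : 'I_l -> set (X -> R))
    (F : I -> set (X -> R)) (act : pred 'I_l) (v0 : X) :
  Defs.convex_set A -> wstar_compact A -> A !=set0 ->
  (forall j, Defs.convex_set (B j)) -> (forall j, wstar_compact (B j)) ->
  (forall j, B j !=set0) -> (forall i, F i `<=` @dual R X) ->
  (forall j b, act j -> B j b -> b v0 < 0) ->
  (forall i c, F i c -> c v0 <= 0) ->
  (forall x, (forall i c, F i c -> c x <= 0) ->
     (forall j b, act j -> B j b -> b x < 0) -> exists2 a, A a & 0 <= a x) ->
  exists lam a b, [/\ forall j, 0 <= lam j, forall j, ~~ act j -> lam j = 0,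
    A a, forall j, B j (b j) &
    wstar_closure (cone_fam F) (fun x => - (a x + \sum_j lam j * b j x))].
Proof.
move=> Ac Aw A0 Bc Bw B0 Fd Bv0 Fv0 opt.
have [a0 Aa0 a0max] := wstar_compact_max v0 Aw A0.
have [b0 b0P] := choice (fun j =>
  let: ex_intro2 b Bb bmax := wstar_compact_max v0 (Bw j) (B0 j) in
  ex_intro (fun b => B j b /\ forall c, B j c -> c v0 <= b v0) b (conj Bb bmax)).
pose M := Num.max 0 (a0 v0).
have M0 : 0 <= M by rewrite le_max lexx.
have sig0 j : act j -> 0 < - b0 j v0.
  by move=> aj; rewrite oppr_gt0; apply: Bv0 aj _; exact: (b0P j).1.
(* Bound on the multipliers: the exact penalty parameter given by v0. *)
pose L j := if act j then M / - b0 j v0 else 0.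
have L0 j : 0 <= L j.
  by rewrite /L; case: ifP => // aj; apply: divr_ge0 => //; exact/ltW/sig0.
have [Dc Dw] := lagrangian_compact_convex B0 L0 _ (index_enum_uniq _) Ac Aw Bc Bw.
have [|||||d [a [lam [b [Aa lamL Bb ->]]]] dcl] :=
    cone_alternative F (lagrangian A B L (index_enum 'I_l)).
- exact: Dc.
- exact: Dw.
- exists (fun x => a0 x + \sum_j 0 * b0 j x), a0, (fun=> 0), b0.
  by split=> // j; [rewrite lexx L0|exact: (b0P j).1].
- exact: Fd.
- move=> x Fx; have [a Aa amax] := wstar_compact_max x Aw A0.
  have [b bP] := choice (fun j =>
    let: ex_intro2 b Bb bmax := wstar_compact_max x (Bw j) (B0 j) in
    ex_intro (fun b => B j b /\ forall c, B j c -> c x <= b x) b (conj Bb bmax)).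
  (* With the maximizers a and b j, these multipliers give the largest Lagrangian value at x, the
     exact penalty function. *)
  pose lam j := if 0 < b j x then L j else 0.
  pose d x := a x + \sum_j lam j * b j x.
  exists d.
    exists a, lam, b; split=> // j; last exact: (bP j).1.
    by rewrite /lam; case: ifP => _; rewrite ?lexx ?L0.
  rewrite leNgt; apply/negP => dx.
  (* theta is the total step along v0 that restores b x <= 0 for every active
     B j; tau then makes these inequalities strict at a cost below - d x. *)
  pose s j := if act j then Num.max 0 (b j x) / - b0 j v0 else 0.
  have s0 j : 0 <= s j.
    rewrite /s; case: ifP => // aj; apply: divr_ge0; last exact/ltW/sig0.
    by rewrite le_max lexx.
  pose theta := \sum_j s j.
  have theta0 : 0 <= theta by rewrite sumr_ge0.
  have lams j : lam j * b j x = s j * M.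
    rewrite /lam /s /L; have [bx|bx] := ltP 0 (b j x); last first.
      by rewrite !mul0r; case: ifP; rewrite mul0r.
    by case: ifP => _; rewrite ?mul0r//; ring.
  have dE : d x = a x + theta * M.
    by rewrite /d mulr_suml; congr (_ + _); apply: eq_bigr => j _; exact: lams.
  pose tau := - d x / (2 * (M + 1)).
  have tau0 : 0 < tau by rewrite divr_gt0//; lra.
  have tauM : tau * M < - d x.
    by rewrite /tau mulrAC ltr_pdivrMr; nra.
  have [i c Fc|j e aj Be|a' Aa'] := opt (x + (theta + tau) *: v0).
  + have dc := Fd i c Fc; rewrite dualD// dualZ//.
    have := Fx i c Fc; have := Fv0 i c Fc; nra.
  + have de := (Bw j).1 e Be; rewrite dualD// dualZ//.
    have ex := (bP j).2 e Be; have ev := (b0P j).2 e Be; have sj := sig0 j aj.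
    have : b j x <= s j * - b0 j v0.
      by rewrite /s aj mulfVK ?gt_eqF// le_max lexx orbT.
    have : s j <= theta.
      by rewrite /theta (bigD1 j)//= lerDl sumr_ge0.
    nra.
  have da := Aw.1 a' Aa'; rewrite dualD// dualZ//.
  have := amax a' Aa'; have := a0max a' Aa'.
  have : a0 v0 <= M by rewrite le_max lexx orbT.
  nra.
exists lam, a, b; split=> //.
- by move=> j; have /andP[] := lamL j.
- move=> j aj; have := lamL j; rewrite /L (negPf aj) => h.
  by apply/eqP; rewrite eq_le andbC.
- by split=> //; apply: dual_opp; apply: Dw.1; exists a, lam, b.
Qed.

(** * Multiplier rule from the quasidifferentials *)

Lemma supp_lt0 {R : realType} {X : normedModType R} (C : set (X -> R)) v c :
  (supp C v < 0)%E -> C c -> c v < 0.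
Proof.
move=> sv Cc; rewrite -lte_fin; apply: le_lt_trans sv.
by apply: ereal_sup_ubound; exists c.
Qed.

Lemma supp_le0 {R : realType} {X : normedModType R} (C : set (X -> R)) v c :
  (supp C v <= 0)%E -> C c -> c v <= 0.
Proof.
move=> sv Cc; rewrite -lee_fin; apply: le_trans sv.
by apply: ereal_sup_ubound; exists c.
Qed.

(** Meant for h in C_i: bending towards the vectors of the other constraints does not increase h, so
    the strict decrease comes from index i alone. *)
Lemma bend_lt0 {R : realType} {X : normedModType R} {m : nat} (v : X)
    (vs ws : 'I_m -> X) (h : X -> R) (t : 'rV[R]_m) (i : 'I_m) :
  dual h -> h v <= 0 ->
  (forall k, k != i -> h (vs k) <= 0 /\ h (ws k) <= 0) ->
  Num.max 0 (- t ord0 i) * h (vs i) + Num.max 0 (t ord0 i) * h (ws i) < 0 ->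
  h (bend v vs ws t) < 0.
Proof.
move=> dh hv hk hi; rewrite /bend dualD// dual_sum// (bigD1 i)//=.
rewrite (dualD dh) !(dualZ dh).
have : \sum_(k < m | k != i)
    h (Num.max 0 (- t ord0 k) *: vs k + Num.max 0 (t ord0 k) *: ws k) <= 0.
  apply: sumr_le0 => k ki; have [hvs hws] := hk k ki.
  rewrite (dualD dh) !(dualZ dh).
  by rewrite -[leRHS]addr0 lerD// mulr_ge0_le0// le_max lexx.
lra.
Qed.

Theorem theorem2 (R : realType) (X : completeNormedModType R) (m l : nat)
  (f0 : X -> R) (f : 'I_m -> X -> R) (g : 'I_l -> X -> R) (xbar : X)
  (lo0 up0 : set (X -> R))
  (lof upf : 'I_m -> set (X -> R)) (log upg : 'I_l -> set (X -> R))
  (xs ys : 'I_m -> X -> R) (zs : 'I_l -> X -> R) :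
  (* xbar is a locally optimal solution *)
  ((forall i, f i xbar = 0) /\ (forall j, g j xbar <= 0)) ->
  (\forall x \near xbar,
      (forall i, f i x = 0) -> (forall j, g j x <= 0) -> f0 xbar <= f0 x) ->
  (* (i) *)
  quasidiff f0 xbar lo0 up0 -> hadamard_dir_diff f0 xbar ->
  (* (ii) *)
  (forall i, \forall y \near xbar, {for y, continuous (f i)}) ->
  (forall i, quasidiff_unif (f i) xbar (lof i) (upf i)) ->
  (* (iii) *)
  (forall j, g j xbar <> 0 ->
     usc_at (g j) xbar /\ quasidiff (g j) xbar (log j) (upg j)) ->
  (forall j, g j xbar = 0 -> quasidiff_unif (g j) xbar (log j) (upg j)) ->
  (* (iv) *)
  (forall i, lof i (xs i)) -> (forall i, upf i (ys i)) ->
  (forall j, upg j (zs j)) ->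
  (forall i, exists v : X,
     (supp (transl (lof i) (ys i)) v < 0)%E /\
     (forall k, k != i ->
        (supp (transl (lof k) (ys k)) v <= 0)%E /\
        (supp (transl (oppset (upf k)) (fun x => - xs k x)%R) v <= 0)%E)) ->
  (forall i, exists w : X,
     (supp (transl (oppset (upf i)) (fun x => - xs i x)%R) w < 0)%E /\
     (forall k, k != i ->
        (supp (transl (oppset (upf k)) (fun x => - xs k x)%R) w <= 0)%E /\
        (supp (transl (lof k) (ys k)) w <= 0)%E)) ->
  (exists v0 : X,
     (forall j, g j xbar = 0 -> (supp (transl (log j) (zs j)) v0 < 0)%E) /\
     (forall i, (supp (transl (lof i) (ys i)) v0 <= 0)%E /\
        (supp (transl (oppset (upf i)) (fun x => - xs i x)%R) v0 <= 0)%E)) ->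
  (* conclusion *)
  forall y0 : X -> R, up0 y0 ->
  exists lam : 'I_l -> R,
    (forall j, 0 <= lam j) /\ (forall j, lam j * g j xbar = 0) /\
    exists2 a, lo0 a &
    exists2 b : 'I_l -> X -> R, (forall j, log j (b j)) &
    exists2 c, wstar_closure
                 (cone_fam (fun i : 'I_m =>
                    transl (lof i) (ys i) `|`
                    transl (oppset (upf i)) (fun x => - xs i x)%R)) c &
    forall x : X,
      a x + y0 x + \sum_(j < l) lam j * (b j x + zs j x) + c x = 0.
Proof.
move=> [fx gx] opt [f0d [[lo0c [lo0w [up0c up0w]]] f0q]] f0H fcont fqd.
move=> gin gact xslo ysup zsup Hv Hw [v0 [Hv0g Hv0f]] y0 y0up.
have [vs vsP] := choice Hv; have [ws wsP] := choice Hw.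
have fd i : dir_diff_unif (f i) xbar by have [] := fqd i.
have fsets i : qd_sets (lof i) (upf i) by have [_ []] := fqd i.
have fq i : qd_formula (f i) xbar (lof i) (upf i) by have [_ []] := fqd i.
have gqd j : quasidiff (g j) xbar (log j) (upg j).
  have [/gact[[gd _] gq]|/gin[_ //]] := pselect (g j xbar = 0).
  by split.
have gsets j : qd_sets (log j) (upg j) by have [_ []] := gqd j.
have gq j : qd_formula (g j) xbar (log j) (upg j) by have [_ []] := gqd j.
pose Flo i := transl (lof i) (ys i).
pose Fup i := transl (oppset (upf i)) (fun x => - xs i x).
pose F i := Flo i `|` Fup i.
have Fd i : F i `<=` @dual R X.
  have [_ [[lod _] [_ [upd _]]]] := fsets i.
  move=> _ [[a Ca [_ -> ->]]|[_ [a Ca ->] [_ -> ->]]].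
    by apply: dual_add; [exact: lod|exact: upd].
  by apply: dual_add; apply: dual_opp; [exact: upd|exact: lod].
have Flo_ge i a : lof i a -> Flo i (fun x => a x + ys i x).
  by move=> la; exists a => //; exists (ys i).
have Fup_ge i b : upf i b -> Fup i (fun x => - b x + - xs i x).
  by move=> ub; exists (fun x => - b x); [exists b|exists (fun x => - xs i x)].
(* The maximum formula at the direction 0 supplies an element. *)
have dd0 (A up : set (X -> R)) h : dir_diff h xbar ->
    qd_formula h xbar A up -> A !=set0.
  by move=> hd hq; have [r /hq[a Aa _]] := hd 0; exists a.
pose A := transl lo0 y0; pose B j := transl (log j) (zs j).
have Fv0 i c : F i c -> c v0 <= 0.
  have [h1 h2] := Hv0f i.
  by case=> Fc; [exact: supp_le0 h1 Fc|exact: supp_le0 h2 Fc].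
have main x : (forall i c, F i c -> c x <= 0) ->
    (forall j b, g j xbar == 0 -> B j b -> b x < 0) ->
    exists2 a, A a & 0 <= a x.
  move=> Fx Bx; have [r hr] := f0d x.
  have [a la [b ub [rE [_ bmin]]]] := f0q x r hr.
  exists (fun x => a x + y0 x); first by exists a => //; exists y0.
  apply: (@le_trans _ _ r); last by rewrite rE lerD2l bmin.
  apply: (@ddir_objective_ge0 R X m l f0 f g xbar x vs ws r) => //.
  - by move=> j /gin[].
  - by move=> j /gact[].
  - move=> t i s ti /(fq i)[a' la' [b' ub' [-> [_ b'min]]]].
    (* The minimum over [upf i] is at most the value of [ys i], so the derivative is bounded by an
       element of [Flo i]. *)
    apply: (@le_lt_trans _ _ (a' (bend x vs ws t) + ys i (bend x vs ws t))).
      by rewrite lerD2l b'min.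
    have Fa := Flo_ge i a' la'.
    apply: (@bend_lt0 _ _ _ _ _ _ (fun x => a' x + ys i x) t i).
    + exact: Fd (or_introl Fa).
    + exact: Fx (or_introl Fa).
    + move=> k; rewrite eq_sym => ik; split.
        exact: supp_le0 ((vsP k).2 i ik).1 Fa.
      exact: supp_le0 ((wsP k).2 i ik).2 Fa.
    + rewrite (max_l (ltW ti)) mul0r addr0 (max_r _); last by rewrite oppr_ge0 ltW.
      by rewrite pmulr_rlt0 ?oppr_gt0//; exact: supp_lt0 (vsP i).1 Fa.
  - move=> t i s ti /(fq i)[a' la' [b' ub' [-> [a'max _]]]].
    rewrite -oppr_lt0 opprD addrC.
    (* Dually, the maximum over [lof i] is at least the value of [xs i], so minus the derivative is
       bounded by an element of [Fup i]. *)
    apply: (@le_lt_trans _ _ (- b' (bend x vs ws t) + - xs i (bend x vs ws t))).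
      by rewrite lerD2l lerN2 a'max.
    have Fb := Fup_ge i b' ub'.
    apply: (@bend_lt0 _ _ _ _ _ _ (fun x => - b' x + - xs i x) t i).
    + exact: Fd (or_intror Fb).
    + exact: Fx (or_intror Fb).
    + move=> k; rewrite eq_sym => ik; split.
        exact: supp_le0 ((vsP k).2 i ik).2 Fb.
      exact: supp_le0 ((wsP k).2 i ik).1 Fb.
    + rewrite (max_r (ltW ti)) (max_l _); last by rewrite oppr_le0 ltW.
      by rewrite mul0r add0r pmulr_rlt0//; exact: supp_lt0 (wsP i).1 Fb.
  - move=> j s /eqP gj /(gq j)[a' la' [b' ub' [-> [_ b'min]]]].
    apply: (@le_lt_trans _ _ (a' x + zs j x)); first by rewrite lerD2l b'min.
    apply: (Bx j (fun x => a' x + zs j x)) => //.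
    by exists a' => //; exists (zs j).
have [||||||||||lam [a [b [lam0 lamact Aa Bb cl]]]] :=
    @lagrange_multipliers R X l 'I_m A B F (fun j => g j xbar == 0) v0.
- exact: transl_convex.
- by apply: transl_compact => //; exact: up0w.1.
- have [a la] := dd0 _ _ _ f0d f0q.
  by exists (fun x => a x + y0 x), a => //; exists y0.
- by move=> j; apply: transl_convex; have [] := gsets j.
- move=> j; have [_ [lw [_ [ud _]]]] := gsets j.
  by apply: transl_compact => //; exact: ud.
- move=> j; have [a la] := dd0 _ _ _ (gqd j).1 (gq j).
  by exists (fun x => a x + zs j x), a => //; exists (zs j).
- exact: Fd.
- by move=> j b /eqP gj; exact: supp_lt0 (Hv0g j gj).
- exact: Fv0.
- exact: main.
have [a' la' [_ -> aE]] := Aa.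
have [b' b'P] := choice (fun j => let: ex_intro2 b' lb (ex_intro2 _ z E) := Bb j in
  ex_intro (fun b' => log j b' /\ b j = (fun x => b' x + zs j x)) b'
    (conj lb (etrans E (congr1 (fun z x => b' x + z x) z)))).
exists lam; split=> //; split.
  move=> j; have [->|gj] := eqVneq (g j xbar) 0; first by rewrite mulr0.
  by rewrite lamact ?mul0r.
exists a' => //; exists b'; first by move=> j; exact: (b'P j).1.
exists (fun x => - (a x + \sum_j lam j * b j x)); first exact: cl.
move=> x; rewrite aE (eq_bigr (fun j => lam j * b j x)) ?subrr// => j _.
by rewrite (b'P j).2.
Qed.
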